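(* Let $U\in\mathbb{R}^{d\times n}$ be a frame and $z\in\mathbb{R}^n_{++}$. For any $0<\delta\le1$ there is $\hat z\in\mathbb{R}^n_{++}$ such that \[\|\mathrm{lev}^U(z)-\mathrm{lev}^U(\hat z)\|_1\le 2nd\delta\qquad\text{and}\qquad \log\frac{\hat z_{\max}}{\hat z_{\min}}\le n\log(\rho(U)/\delta).\]
   Context: A frame is a matrix $U=(u_1,\dots,u_n)\in\mathbb{R}^{d\times n}$ of full row rank; $U_T$ is the submatrix of columns indexed by $T$. For $z\in\mathbb{R}^n_{++}$, $Z=\mathrm{diag}(z)$ and $\mathrm{lev}^U_j(z):=z_ju_j^{\mathsf T}(UZU^{\mathsf T})^{-1}u_j$. $\hat z_{\max},\hat z_{\min}$ denote the largest and smallest entries of $\hat z$. For nonempty $T\subseteq[n]$, $\rho_T(U):=\|((UU^{\mathsf T})^{-1/2}U_T)^{+}\|_{\mathrm{op}}^2-1$, where ${}^{+}$ is the Moore–Penrose pseudo-inverse, and $\rho(U):=\max_{T}\rho_T(U)$. *)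

(* Defs.v *)
From HB Require Import structures.
From mathcomp Require Import all_boot all_order all_algebra.
From mathcomp Require Import all_classical all_reals all_analysis.
Set Implicit Arguments. Unset Strict Implicit. Unset Printing Implicit Defensive.
Import Order.TTheory GRing.Theory Num.Theory.
Local Open Scope ring_scope.
Local Open Scope classical_set_scope.

Section Defs.
Variable R : realType.

Definition vnorm k (x : 'cV[R]_k) : R := Num.sqrt (\sum_i x i 0 ^+ 2).

Definition opnorm m k (A : 'M[R]_(m, k)) : R :=
  sup [set r | exists x : 'cV[R]_k, x != 0 /\ r = vnorm (A *m x) / vnorm x].

(* Moore-Penrose pseudo-inverse, via the four Penrose equations *)
Definition is_pinv m k (A : 'M[R]_(m, k)) (X : 'M[R]_(k, m)) : Prop :=
  [/\ A *m X *m A = A, X *m A *m X = X,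
      (A *m X)^T = A *m X & (X *m A)^T = X *m A].
Definition pinv m k (A : 'M[R]_(m, k)) : 'M[R]_(k, m) :=
  xget 0 [set X | is_pinv A X].

Definition psd k (S : 'M[R]_k) : Prop :=
  S^T = S /\ forall x : 'cV[R]_k, 0 <= (x^T *m S *m x) 0 0.

Definition invsqrtmx k (M : 'M[R]_k) : 'M[R]_k :=
  xget 0 [set S | psd S /\ S *m S = invmx M].

Definition diagz n (z : 'I_n -> R) : 'M[R]_n := diag_mx (\row_j z j).

Definition lev d n (U : 'M[R]_(d, n)) (z : 'I_n -> R) (j : 'I_n) : R :=
  z j * ((col j U)^T *m invmx (U *m diagz z *m U^T) *m col j U) 0 0.

Definition colsT d n (U : 'M[R]_(d, n)) (T : {set 'I_n}) : 'M[R]_(d, #|T|) :=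
  colsub (fun k : 'I_#|T| => enum_val k) U.

Definition rhoT d n (U : 'M[R]_(d, n)) (T : {set 'I_n}) : R :=
  opnorm (pinv (invsqrtmx (U *m U^T) *m colsT U T)) ^+ 2 - 1.

Definition rho d n (U : 'M[R]_(d, n)) : R :=
  \big[Num.max/0]_(T : {set 'I_n} | T != finset.set0) rhoT U T.

Definition zmax n (z : 'I_n -> R) : R := \big[Num.max/0]_j z j.
Definition zmin n (z : 'I_n -> R) : R := \big[Num.min/zmax z]_j z j.

End Defs.

(* Main.v *)
Require Import Defs.
From HB Require Import structures.
From mathcomp Require Import all_boot all_order all_algebra.
From mathcomp Require Import all_classical all_reals all_analysis.
From mathcomp Require Import spectral sesquilinear complex ring lra.
Set Implicit Arguments. Unset Strict Implicit. Unset Printing Implicit Defensive.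
Import Order.TTheory GRing.Theory Num.Theory.
Local Open Scope ring_scope.

(** Let kappa = rho(U) / delta.  If all entries of y on T exceed all entries off
    T by a factor kappa, then the leverage scores of T sum to at least
    (1 - delta) rank U_T.  To see this, monotonicity of that sum in the entries
    reduces to y = s on T and y = t off T, where simultaneous diagonalization of
    U U^T and U_T U_T^T turns the sum into that of s l / (s l + t (1 - l)) over
    eigenvalues l; here l = 0 or (1 + rho(U)) l >= 1.  As rank U_T always bounds
    the sum from above, and scaling y up on T increases every leverage score in T
    and decreases every other one, such a scaling moves the scores by at most
    2 d delta in l1-norm.  Hence each gap of ratio larger than kappa between
    consecutive values of z can be shrunk to kappa at that cost; there are at
    most n gaps.  If delta < rho(U) fails, then, since rho(U) >= 1 or
    rho(U) = 0, either delta = rho(U) = 1 and the bounds are trivial, or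
    rho(U) = 0 and the leverage scores do not depend on z. *)

(** * Spectral theorem for real symmetric matrices *)

(** Over the complex numbers A is Hermitian, hence unitarily diagonalizable with real spectrum; a
    real root of the characteristic polynomial descends to the base field. *)
Lemma symmetric_eigenvalue (R : rcfType) n (A : 'M[R]_n.+1) :
  A^T = A -> exists a, eigenvalue A a.
Proof.
move=> symA; pose f := real_complex R; pose Ac := map_mx f A.
have hermAc : Ac \is hermsymmx.
  apply: realsym_hermsym.
    apply/is_hermitianmxP; rewrite expr0 scale1r map_mx_id //.
    by rewrite /Ac -{1}symA; apply/matrixP => i j; rewrite !mxE.
  by apply/mxOverP => i j; rewrite mxE complex_real.
have /orthomx_spectralP AcE := hermitian_normalmx hermAc.
have /mxOverP/(_ 0 0) := hermitian_spectral_diag_real hermAc.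
move=> /complex_realP[a la].
exists a; rewrite eigenvalue_root_char -(fmorph_root f) map_char_poly.
rewrite -eigenvalue_root_char -/Ac.
(* The rows of the diagonalizing matrix are eigenvectors, and nonzero because it is invertible. *)
apply/eigenvalueP; exists (row 0 (spectralmx Ac)); last first.
  apply: contraTneq (spectral_unit Ac) => row0.
  have /(congr1 (fun v => v *m invmx (spectralmx Ac))) := row0.
  rewrite mul0mx -row_mul; case: (boolP (_ \in unitmx)) => // uP.
  rewrite mulmxV // => /matrixP/(_ 0 0); rewrite !mxE /= => /eqP.
  by rewrite oner_eq0.
rewrite {2}AcE -row_mul !mulmxA mulmxV ?spectral_unit // mul1mx.
by rewrite row_mul row_diag_mx -scalemxAl la -rowE.
Qed.

(* Householder reflection *)
Lemma orthogonal_first_col (R : rcfType) n (v : 'cV[R]_n.+1) :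
  v^T *m v = 1%:M ->
  exists H : 'M[R]_n.+1, [/\ H^T = H, H *m H = 1%:M & H *m delta_mx 0 0 = v].
Proof.
move=> v1; pose e : 'cV[R]_n.+1 := delta_mx 0 0.
have e1 : e^T *m e = 1%:M by rewrite /e trmx_delta mul_delta_mx; apply/matrixP=> i j; rewrite !ord1 !mxE.
have [->|nve] := eqVneq v e.
  by exists 1%:M; split; rewrite ?trmx1 ?mul1mx.
pose w := v - e; pose a := (v^T *m e) 0 0.
have ve : v^T *m e = a%:M by rewrite [LHS]mx11_scalar.
have ev : e^T *m v = a%:M by rewrite -[LHS]trmxK trmx_mul trmxK ve tr_scalar_mx.
have we : w^T *m e = (a - 1)%:M.
  by rewrite /w linearB /= mulmxBl ve e1 -[1%:M]/(1%:M) -raddfB.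
have ww : w^T *m w = (2 * (1 - a))%:M.
  rewrite {2}/w mulmxBr we /w linearB /= mulmxBl v1 ev -!raddfB /=.
  by congr (_%:M); ring.
have a1 : 1 - a != 0.
  apply: contra_neq nve => a1; apply/eqP; rewrite -subr_eq0 -/w; apply/eqP.
  move: ww; rewrite a1 mulr0 => /matrixP/(_ 0 0); rewrite !mxE mulr1n => /eqP.
  rewrite psumr_eq0 => [/allP w0|i _]; last by rewrite mxE -expr2 sqr_ge0.
  apply/matrixP => i j; rewrite ord1 [RHS]mxE; apply/eqP.
  by have := w0 i (mem_index_enum i); rewrite mxE mulf_eq0 orbb.
have wE : v = w + e by rewrite subrK.
pose P := w *m w^T; have Pe : P *m e = (a - 1) *: w.
  by rewrite -mulmxA we mul_mx_scalar.
have PP : P *m P = (2 * (1 - a)) *: P.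
  by rewrite /P mulmxA -[w *m _ *m w]mulmxA ww mul_mx_scalar -scalemxAl.
have PT : P^T = P by rewrite trmx_mul trmxK.
(* Since w^T w = 2 (1 - a), this is 1 - 2 w w^T / (w^T w), the reflection that exchanges e and v. *)
exists (1%:M - (1 - a)^-1 *: P); clearbody P w; split.
- by rewrite linearB linearZ /= trmx1 PT.
- rewrite mulmxBr mulmx1 mulmxBl mul1mx -scalemxAr -scalemxAl PP !scalerA.
  have -> : (1 - a)^-1 * (1 - a)^-1 * (2 * (1 - a)) = 2 * (1 - a)^-1 by field.
  by rewrite mulrDl mul1r scalerDl opprB addrK subrK.
rewrite mulmxBl mul1mx -scalemxAl -/e Pe scalerA.
have -> : (1 - a)^-1 * (a - 1) = -1 by field.
by rewrite scaleN1r opprK wE addrC.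
Qed.

(** Induction on the dimension: a reflection H taking the first basis vector to a unit eigenvector
    makes H A H block diagonal, with a scalar block and a smaller symmetric one. *)
Lemma spectral_symmetric (R : rcfType) n (A : 'M[R]_n) :
  A^T = A ->
  exists (Q : 'M[R]_n) (D : 'rV[R]_n), Q *m Q^T = 1%:M /\ A = Q *m diag_mx D *m Q^T.
Proof.
elim: n A => [|n IH] A symA.
  by exists 0, 0; split; apply/matrixP => -[].
have [a /eigenvalueP[u uA u0]] := symmetric_eigenvalue symA.
have uu_gt0 : 0 < (u *m u^T) 0 0.
  rewrite mxE lt_def psumr_eq0 ?sumr_ge0 => [|i _|i _]; rewrite ?mxE -?expr2 ?sqr_ge0 //.
  rewrite andbT; apply: contra_neqN u0 => /allP u0.
  apply/rowP => i; have := u0 i (mem_index_enum i).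
  by rewrite !mxE mulf_eq0 orbb => /eqP.
pose v := (Num.sqrt ((u *m u^T) 0 0))^-1 *: u^T.
have v1 : v^T *m v = 1%:M.
  rewrite /v [(_ *: _)^T]linearZ /= trmxK -scalemxAl -scalemxAr scalerA.
  rewrite {3}[u *m u^T]mx11_scalar scale_scalar_mx -expr2 exprVn.
  by rewrite sqr_sqrtr ?ltW // mulVf // gt_eqF.
have Av : A *m v = a *: v.
  by rewrite /v -scalemxAr -{1}symA -trmx_mul uA linearZ /= !scalerA mulrC.
clearbody v; have [H [HT HH He]] := orthogonal_first_col v1.
pose B : 'M[R]_(1 + n) := H *m A *m H.
have BT : B^T = B by rewrite /B !trmx_mul HT symA mulmxA.
have B1 : B *m (delta_mx 0 0 : 'cV_(1 + n)) = a *: delta_mx 0 0.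
  by rewrite -mulmxA He -mulmxA Av -scalemxAr -He mulmxA HH mul1mx.
have BE0 : H *m B *m H = A.
  by rewrite /B -!mulmxA HH mulmx1 mulmxA HH mul1mx.
clearbody B.
have Bl : dlsubmx B = 0.
  apply/matrixP => i j; rewrite !mxE ord1.
  have /matrixP/(_ (rshift 1 i) 0) := B1.
  rewrite -colE !mxE /= mulr0 => <-.
  by congr (B _ _); apply/val_inj.
have Br : ursubmx B = 0 by rewrite -[LHS]trmxK trmx_ursub BT Bl trmx0.
have [Q [D [QQ BE]]] : exists (Q : 'M[R]_n) (D : 'rV[R]_n),
    Q *m Q^T = 1%:M /\ drsubmx B = Q *m diag_mx D *m Q^T.
  by apply: IH; rewrite trmx_drsub BT.
pose Q' : 'M[R]_(1 + n) := block_mx 1%:M 0 0 Q.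
have Q'T : Q'^T = block_mx 1%:M 0 0 Q^T by rewrite tr_block_mx !trmx0 trmx1.
have QQ' : Q' *m Q'^T = 1%:M.
  by rewrite Q'T mulmx_block !mulmx0 !mul0mx !mulmx1 !addr0 add0r QQ -scalar_mx_block.
exists (H *m Q'), (row_mx (ulsubmx B) D); split.
  by rewrite trmx_mul HT -mulmxA (mulmxA Q') QQ' mul1mx.
have BE' : B = Q' *m diag_mx (row_mx (ulsubmx B) D) *m Q'^T.
  rewrite diag_mx_row Q'T !mulmx_block !(mulmx0, mul0mx, mulmx1, mul1mx, addr0, add0r).
  rewrite -BE -[LHS]submxK Bl Br; congr block_mx.
  by apply/matrixP => i j; rewrite !ord1 !mxE mulr1n.
by rewrite trmx_mul HT -[LHS]BE0 [in LHS]BE' !mulmxA.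
Qed.

(** * Quadratic forms and positive definite matrices *)

Definition qform (R : rcfType) n (A : 'M[R]_n) (x : 'cV[R]_n) : R :=
  (x^T *m A *m x) 0 0.

Definition posdef (R : rcfType) n (A : 'M[R]_n) :=
  A^T = A /\ forall x : 'cV[R]_n, x != 0 -> 0 < qform A x.

Lemma qformD (R : rcfType) n (A B : 'M[R]_n) x :
  qform (A + B) x = qform A x + qform B x.
Proof. by rewrite /qform mulmxDr mulmxDl mxE. Qed.

Lemma qformZ (R : rcfType) n a (A : 'M[R]_n) x : qform (a *: A) x = a * qform A x.
Proof. by rewrite /qform -scalemxAr -scalemxAl mxE. Qed.

Lemma qform_congr (R : rcfType) m n (A : 'M[R]_n) (P : 'M[R]_(n, m)) x :
  qform (P^T *m A *m P) x = qform A (P *m x).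
Proof. by rewrite /qform trmx_mul !mulmxA. Qed.

Lemma qform_delta (R : rcfType) n (A : 'M[R]_n) i :
  qform A (delta_mx i 0) = A i i.
Proof. by rewrite /qform trmx_delta -rowE -colE !mxE. Qed.

Lemma qform_diag (R : rcfType) n (D : 'rV[R]_n) x :
  qform (diag_mx D) x = \sum_i D 0 i * x i 0 ^+ 2.
Proof.
rewrite /qform -mulmxA mxE; apply: eq_bigr => i _.
by rewrite mul_diag_mx !mxE mulrCA mulrA.
Qed.

Lemma qform1 (R : rcfType) n (x : 'cV[R]_n) : qform 1%:M x = \sum_i x i 0 ^+ 2.
Proof.
by rewrite -diag_const_mx qform_diag; apply: eq_bigr => i _; rewrite mxE mul1r.
Qed.

Lemma qform1_ge0 (R : rcfType) n (x : 'cV[R]_n) : 0 <= qform 1%:M x.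
Proof. by rewrite qform1 sumr_ge0 // => i _; rewrite sqr_ge0. Qed.

Lemma qform1_eq0 (R : rcfType) n (x : 'cV[R]_n) : (qform 1%:M x == 0) = (x == 0).
Proof.
rewrite qform1; apply/eqP/eqP => [|->]; last first.
  by rewrite big1 // => i _; rewrite mxE expr0n.
move/eqP; rewrite psumr_eq0 => [/allP x0|i _]; last exact: sqr_ge0.
apply/colP => i; rewrite mxE; apply/eqP.
by have := x0 i (mem_index_enum i); rewrite sqrf_eq0.
Qed.

Lemma posdef_unit (R : rcfType) n (A : 'M[R]_n) : posdef A -> A \in unitmx.
Proof.
case=> symA posA; rewrite -row_free_unit -kermx_eq0; apply/rowV0P => v.
move=> /sub_kermxP vA; apply/eqP; apply: contraT => v0.
have := posA v^T; rewrite trmx_eq0 => /(_ v0).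
by rewrite /qform trmxK vA mul0mx mxE ltxx.
Qed.

Lemma posdef_inv_sym (R : rcfType) n (A : 'M[R]_n) :
  posdef A -> (invmx A)^T = invmx A.
Proof. by case=> symA _; rewrite trmx_inv symA. Qed.

(* Variationally, qform (invmx A) x is the maximum over y of 2 x.y - qform A y. *)
Lemma qform_inv_anti (R : rcfType) n (A B : 'M[R]_n) x : posdef A -> posdef B ->
  (forall y, qform A y <= qform B y) -> qform (invmx B) x <= qform (invmx A) x.
Proof.
move=> pA pB AB; set y := invmx B *m x; set z := invmx A *m x.
have xE : B *m y = x by rewrite mulKVmx ?posdef_unit.
have xE' : A *m z = x by rewrite mulKVmx ?posdef_unit.
(* Expanded, this reads 2 x.y - qform A y <= x.z, while qform A y <= qform B y = x.y. *)
have Ay : 0 <= qform A (y - z).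
  have [->|/(pA.2 _)/ltW//] := eqVneq (y - z) 0.
  by rewrite /qform mulmx0 mxE.
have dotC (u v : 'cV[R]_n) : (u^T *m v) 0 0 = (v^T *m u) 0 0.
  by rewrite -[u^T *m v]trmxK trmx_mul trmxK mxE.
have qBx : qform (invmx B) x = (x^T *m y) 0 0 by rewrite /qform -mulmxA.
have qAx : qform (invmx A) x = (x^T *m z) 0 0 by rewrite /qform -mulmxA.
clearbody y z.
have qBy : qform B y = (x^T *m y) 0 0 by rewrite /qform -mulmxA xE dotC.
have := AB y; rewrite qBy => le_AB.
have qA : qform A (y - z) = qform A y - 2 * (x^T *m y) 0 0 + (x^T *m z) 0 0.
  rewrite /qform [(y - z)^T]linearB /= 2!mulmxBl !mulmxBr -!mulmxA xE' !mulmxA.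
  have -> : z^T *m A = x^T by rewrite -{1}pA.1 -trmx_mul xE'.
  have mxB (P Q : 'M[R]_1) : (P - Q) 0 0 = P 0 0 - Q 0 0 by rewrite !mxE.
  by rewrite !mxB [(y^T *m x) 0 0]dotC [(z^T *m x) 0 0]dotC; ring.
by rewrite qBx qAx; lra.
Qed.

Lemma posdef_factor (R : rcfType) n (A : 'M[R]_n) : posdef A ->
  exists2 S : 'M[R]_n, posdef S & S *m S = invmx A.
Proof.
case=> symA posA; have [Q [D [QQ AE]]] := spectral_symmetric symA.
have QQ' : Q^T *m Q = 1%:M by exact: mulmx1C.
have D_gt0 i : 0 < D 0 i.
  have := posA (Q *m delta_mx i 0).
  rewrite -qform_congr AE !mulmxA QQ' mul1mx -mulmxA QQ' mulmx1 qform_delta.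
  rewrite !mxE eqxx mulr1n; apply; apply/eqP => Q0.
  have /matrixP/(_ i 0) : Q^T *m (Q *m delta_mx i 0) = (0 : 'cV[R]_n).
    by rewrite Q0 mulmx0.
  by rewrite mulmxA QQ' mul1mx !mxE !eqxx => /eqP; rewrite oner_eq0.
pose E : 'rV[R]_n := \row_i (Num.sqrt (D 0 i))^-1.
have E_gt0 i : 0 < E 0 i by rewrite mxE invr_gt0 sqrtr_gt0.
exists (Q *m diag_mx E *m Q^T).
  split=> [|x x0]; first by rewrite !trmx_mul trmxK tr_diag_mx mulmxA.
  rewrite -{1}(trmxK Q) qform_congr qform_diag.
  have Qx0 : Q^T *m x != 0.
    apply: contra_neq x0 => Qx; have : Q *m (Q^T *m x) = 0 by rewrite Qx mulmx0.
    by rewrite mulmxA QQ mul1mx.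
  rewrite lt_def sumr_ge0 ?andbT => [|i _]; last by rewrite mulr_ge0 ?sqr_ge0 ?ltW.
  apply: contra_neqN Qx0; rewrite psumr_eq0 => [/allP y0|i _]; last first.
    by rewrite mulr_ge0 ?sqr_ge0 ?ltW.
  apply/colP => i; have := y0 i (mem_index_enum i).
  by rewrite mulf_eq0 gt_eqF //= sqrf_eq0 => /eqP ->; rewrite mxE.
have uA : A \in unitmx by apply: posdef_unit.
apply: (can_inj (mulKmx uA)); rewrite mulmxV // AE -!mulmxA.
rewrite (mulmxA Q^T Q) QQ' mul1mx (mulmxA Q^T Q) QQ' mul1mx.
rewrite (mulmxA (diag_mx E)) (mulmxA (diag_mx D)) !mulmx_diag.
have -> : diag_mx (\row_j (D 0 j * (\row_j (E 0 j * E 0 j)) 0 j)) = 1%:M :> 'M[R]_n.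
  rewrite -diag_const_mx; congr diag_mx; apply/rowP => i; rewrite !mxE.
  rewrite -invfM -expr2 sqr_sqrtr ?ltW // mulfV // gt_eqF //.
by rewrite mul1mx.
Qed.

(** With S = M^(-1/2), diagonalize S G S = Q D Q^T and take W = Q^T S^(-1). *)
Lemma simultaneous_diagonalization (R : rcfType) n (M G : 'M[R]_n) :
  posdef M -> G^T = G -> exists (W : 'M[R]_n) (D : 'rV[R]_n),
    [/\ W \in unitmx, M = W^T *m W & G = W^T *m diag_mx D *m W].
Proof.
move=> pM symG; have [S pS SS] := posdef_factor pM.
have uS := posdef_unit pS; have uM := posdef_unit pM.
have ST := pS.1; have SVT := posdef_inv_sym pS.
have [Q [D [QQ SGS]]] : exists (Q : 'M[R]_n) (D : 'rV[R]_n),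
    Q *m Q^T = 1%:M /\ S *m G *m S = Q *m diag_mx D *m Q^T.
  by apply: spectral_symmetric; rewrite !trmx_mul ST symG mulmxA.
have QQ' : Q^T *m Q = 1%:M by exact: mulmx1C.
have [uQ _] := mulmx1_unit QQ.
exists (Q^T *m invmx S), D; split.
- by rewrite unitmx_mul unitmx_tr uQ unitmx_inv.
- rewrite trmx_mul trmxK SVT mulmxA -(mulmxA _ Q) QQ mulmx1.
  rewrite -[M]invmxK -SS; apply: (can_inj (mulKmx uS)).
  apply: (can_inj (mulKmx uS)); rewrite mulKVmx // mulmxV // mulmxA.
  by rewrite mulmxV // unitmx_mul uS.
rewrite trmx_mul trmxK SVT; have -> : invmx S *m Q *m diag_mx D *m (Q^T *m invmx S) =
   invmx S *m (Q *m diag_mx D *m Q^T) *m invmx S by rewrite !mulmxA.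
by rewrite -SGS -!mulmxA mulKmx // mulmxV // mulmx1.
Qed.

(** * Pseudo-inverse, operator norm and inverse square root *)

(** A full-rank factorization A = C F gives the explicit solution X = F^T (F F^T)^(-1) (C^T C)^(-1)
    C^T. *)
Lemma penrose_exists (R : rcfType) m n (A : 'M[R]_(m, n)) :
  exists X : 'M[R]_(n, m), [/\ A *m X *m A = A, X *m A *m X = X,
      (A *m X)^T = A *m X & (X *m A)^T = X *m A].
Proof.
have gram_unit p q (B : 'M[R]_(p, q)) : row_free B -> B *m B^T \in unitmx.
  move=> fB; rewrite -row_free_unit -kermx_eq0; apply/rowV0P => v.
  move=> /sub_kermxP vBB; have /eqP : qform 1%:M (B^T *m v^T) = 0.
    by rewrite /qform mulmx1 -trmx_mul trmxK -mulmxA trmx_mul (mulmxA B) mulmxA vBB mul0mx mxE.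
  rewrite qform1_eq0 -trmx_mul trmx_eq0 => /eqP vB.
  by apply: (row_free_inj fB); rewrite vB mul0mx.
have [r [C [F [AE fF fC]]]] : exists r (C : 'M[R]_(m, r)) (F : 'M[R]_(r, n)),
    [/\ A = C *m F, row_free F & row_full C].
  exists (\rank A), (col_base A), (row_base A).
  by rewrite mulmx_base row_base_free col_base_full.
have uF : F *m F^T \in unitmx by apply: gram_unit.
have uC : C^T *m C \in unitmx.
  rewrite -{2}[C]trmxK; apply: gram_unit.
  by rewrite /row_free mxrank_tr.
pose K := invmx (F *m F^T); pose L := invmx (C^T *m C).
have KT : K^T = K by rewrite /K trmx_inv trmx_mul trmxK.
have LT : L^T = L by rewrite /L trmx_inv trmx_mul trmxK.
have FK : F *m F^T *m K = 1%:M by rewrite mulmxV.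
have LC : L *m (C^T *m C) = 1%:M by rewrite mulVmx.
pose X := F^T *m K *m L *m C^T.
have AX : A *m X = C *m L *m C^T.
  by rewrite AE /X !mulmxA -(mulmxA C F) -(mulmxA C (F *m _)) FK mulmx1.
have XA : X *m A = F^T *m K *m F.
  by rewrite AE /X !mulmxA -(mulmxA _ C^T C) -(mulmxA _ L) LC mulmx1.
exists X; split.
- by rewrite AX AE mulmxA -!mulmxA (mulmxA C^T) (mulmxA L) LC mul1mx.
- by rewrite XA /X !mulmxA -(mulmxA _ F) -(mulmxA _ (F *m _)) FK mulmx1.
- by rewrite AX !trmx_mul trmxK LT mulmxA.
by rewrite XA !trmx_mul trmxK KT mulmxA.
Qed.

Lemma vnorm_sqr (R : realType) k (x : 'cV[R]_k) : vnorm x ^+ 2 = qform 1%:M x.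
Proof. by rewrite qform1 sqr_sqrtr // sumr_ge0 // => i _; rewrite sqr_ge0. Qed.

Lemma vnorm_ge0 (R : realType) k (x : 'cV[R]_k) : 0 <= vnorm x.
Proof. exact: sqrtr_ge0. Qed.

Lemma vnorm_gt0 (R : realType) k (x : 'cV[R]_k) : x != 0 -> 0 < vnorm x.
Proof.
move=> x0; rewrite lt_def vnorm_ge0 andbT.
by rewrite -sqrf_eq0 vnorm_sqr qform1_eq0.
Qed.

Lemma qform1_mul (R : rcfType) m k (A : 'M[R]_(m, k)) x :
  qform 1%:M (A *m x) = qform (A^T *m A) x.
Proof. by rewrite -qform_congr mulmx1. Qed.

(** Without an upper bound the [sup] in [opnorm] would carry no information. The squared ratios are
    at most the sum of the absolute eigenvalues of A^T A. *)
Lemma opnorm_bounded (R : realType) m k (A : 'M[R]_(m, k)) :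
  has_ubound [set r | exists x : 'cV[R]_k, x != 0 /\ r = vnorm (A *m x) / vnorm x].
Proof.
have [|Q [D [QQ AE]]] := @spectral_symmetric R k (A^T *m A).
  by rewrite trmx_mul trmxK.
pose C := \sum_i `|D 0 i|.
have C0 : 0 <= C by apply: sumr_ge0.
exists (Num.sqrt C) => _ [x [x0 ->]]; rewrite ler_pdivrMr ?vnorm_gt0 //.
rewrite -ler_sqr ?nnegrE ?mulr_ge0 ?sqrtr_ge0 // exprMn !vnorm_sqr sqr_sqrtr //.
rewrite qform1_mul AE -{1}(trmxK Q) qform_congr qform_diag.
have {2}-> : x = Q *m (Q^T *m x) by rewrite mulmxA QQ mul1mx.
rewrite qform1_mul (mulmx1C QQ) qform1 mulr_sumr.
apply: ler_sum => i _; rewrite ler_wpM2r ?sqr_ge0 //.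
by rewrite (le_trans (ler_norm _)) // /C (bigD1 i) //= lerDl sumr_ge0.
Qed.

Lemma vnorm_opnorm (R : realType) m k (A : 'M[R]_(m, k)) x :
  vnorm (A *m x) <= opnorm A * vnorm x.
Proof.
have [->|x0] := eqVneq x 0.
  rewrite mulmx0; suff v0 p : vnorm (0 : 'cV[R]_p) = 0 by rewrite !v0 mulr0.
  by apply/eqP; rewrite -sqrf_eq0 vnorm_sqr qform1_eq0.
rewrite -ler_pdivrMr ?vnorm_gt0 //; apply: ub_le_sup.
  exact: opnorm_bounded.
by exists x.
Qed.

Lemma opnorm_ge0 (R : realType) m k (A : 'M[R]_(m, k)) : 0 <= opnorm A.
Proof.
have [[r Ar]|/nonemptyPn A0] := pselect (nonempty
    [set r | exists x : 'cV[R]_k, x != 0 /\ r = vnorm (A *m x) / vnorm x]).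
  apply: le_trans (ub_le_sup (opnorm_bounded A) Ar).
  by have [x [_ ->]] := Ar; rewrite divr_ge0 ?vnorm_ge0.
(* When there is no nonzero vector, the set is empty and [sup] is 0. *)
by rewrite /opnorm A0 sup0.
Qed.

Lemma opnorm_le1 (R : realType) m k (A : 'M[R]_(m, k)) :
  (forall x, qform 1%:M (A *m x) <= qform 1%:M x) -> opnorm A <= 1.
Proof.
move=> Ax; have [A0|/nonemptyPn A0] := pselect (nonempty
    [set r | exists x : 'cV[R]_k, x != 0 /\ r = vnorm (A *m x) / vnorm x]).
  apply: ge_sup => // _ [x [x0 ->]]; rewrite ler_pdivrMr ?vnorm_gt0 // mul1r.
  by rewrite -ler_sqr ?nnegrE ?vnorm_ge0 // !vnorm_sqr.
by rewrite /opnorm A0 sup0.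
Qed.

Lemma pinvP (R : realType) m k (A : 'M[R]_(m, k)) : is_pinv A (Defs.pinv A).
Proof.
have [X AX] := penrose_exists A.
by rewrite /Defs.pinv; case: xgetP => [Y -> //|/(_ X)]; case.
Qed.

Lemma invsqrtmxP (R : realType) k (M : 'M[R]_k) : posdef M ->
  [/\ (invsqrtmx M)^T = invsqrtmx M, invsqrtmx M *m invsqrtmx M = invmx M
    & invsqrtmx M \in unitmx].
Proof.
move=> pM; have uM := posdef_unit pM.
suff [[ST _] SS] : psd (invsqrtmx M) /\ invsqrtmx M *m invsqrtmx M = invmx M.
  split=> //; have : invsqrtmx M *m invsqrtmx M \in unitmx by rewrite SS unitmx_inv.
  by rewrite unitmx_mul andbb.
have [S [ST pS] SS] := posdef_factor pM.
have psdS : psd S.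
  split=> // x; have [->|/pS/ltW//] := eqVneq x 0.
  by rewrite mulmx0 mxE.
by rewrite /invsqrtmx; case: xgetP => [Y -> //|/(_ S)]; case.
Qed.

(** * Frame operators of weighted columns *)

Definition ind (R : realType) n (T : {set 'I_n}) (i : 'I_n) : R := (i \in T)%:R.
Arguments ind R {n} T i.

Definition frame_op (R : realType) d n (U : 'M[R]_(d, n)) (z : 'I_n -> R) :=
  U *m diagz z *m U^T.

Lemma frame_op_sym (R : realType) d n (U : 'M[R]_(d, n)) z :
  (frame_op U z)^T = frame_op U z.
Proof. by rewrite /frame_op !trmx_mul trmxK tr_diag_mx mulmxA. Qed.

Lemma qform_frame (R : realType) d n (U : 'M[R]_(d, n)) z x :
  qform (frame_op U z) x = \sum_i z i * (U^T *m x) i 0 ^+ 2.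
Proof.
rewrite /frame_op -{1}(trmxK U) qform_congr qform_diag.
by apply: eq_bigr => i _; rewrite mxE.
Qed.

Lemma frame_op_posdef (R : realType) d n (U : 'M[R]_(d, n)) z :
  row_free U -> (forall i, 0 < z i) -> posdef (frame_op U z).
Proof.
move=> fU z_gt0; split=> [|x x0]; first exact: frame_op_sym.
rewrite qform_frame lt_def sumr_ge0 ?andbT => [|i _]; last first.
  by rewrite mulr_ge0 ?sqr_ge0 ?ltW.
apply: contra_neqN x0; rewrite psumr_eq0 => [/allP y0|i _]; last first.
  by rewrite mulr_ge0 ?sqr_ge0 ?ltW.
have xU : x^T *m U = 0 *m U.
  rewrite mul0mx -[LHS]trmxK trmx_mul trmxK -[RHS]trmxK trmx0; congr trmx.
  apply/colP => i; have := y0 i (mem_index_enum i).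
  by rewrite mulf_eq0 gt_eqF //= sqrf_eq0 => /eqP ->; rewrite mxE.
by rewrite -[LHS]trmxK (row_free_inj fU xU) trmx0.
Qed.

Lemma frame_op_lin (R : realType) d n (U : 'M[R]_(d, n)) (T : {set 'I_n}) a b z :
  (forall i, z i = if i \in T then a else b) ->
  frame_op U z = a *: frame_op U (ind R T) + b *: frame_op U (ind R (~: T)).
Proof.
move=> zE; rewrite /frame_op.
have -> : diagz z = a *: diagz (ind R T) + b *: diagz (ind R (~: T)).
  apply/matrixP => i j; rewrite !mxE /ind !inE zE.
  by case: (i \in T); rewrite /= !mulr1n ?mulr0n; case: (i == j); rewrite /= ?mulr1n ?mulr0n; ring.
by rewrite mulmxDr mulmxDl -!scalemxAr -!scalemxAl.
Qed.

Lemma frame_op_const1 (R : realType) d n (U : 'M[R]_(d, n)) :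
  frame_op U (fun=> 1) = U *m U^T.
Proof.
rewrite /frame_op; have -> : diagz (fun=> 1) = 1%:M :> 'M[R]_n.
  by rewrite -diag_const_mx; congr diag_mx; apply/rowP => i; rewrite !mxE.
by rewrite mulmx1.
Qed.

Lemma frame_op_setC (R : realType) d n (U : 'M[R]_(d, n)) (T : {set 'I_n}) :
  frame_op U (ind R T) + frame_op U (ind R (~: T)) = U *m U^T.
Proof.
rewrite -frame_op_const1 (@frame_op_lin _ _ _ U T 1 1 (fun=> 1)) ?scale1r // => i.
by rewrite if_same.
Qed.

(** Trades the submatrix, whose type depends on T, for 0/1 weights on all columns. *)
Lemma colsT_gram (R : realType) d n (U : 'M[R]_(d, n)) (T : {set 'I_n}) :
  colsT U T *m (colsT U T)^T = frame_op U (ind R T).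
Proof.
apply/matrixP => i j; rewrite mxE.
under eq_bigr => k _ do rewrite !mxE.
rewrite -(big_enum_val (fun l => U i l * U j l)) /= big_mkcond /= mxE.
apply: eq_bigr => l _; rewrite mul_mx_diag !mxE /ind.
by case: (l \in T); rewrite ?mulr1 ?mulr0 ?mul0r.
Qed.

(** * Spectral meaning of rho *)

Lemma rho_ge0 (R : realType) d n (U : 'M[R]_(d, n)) : 0 <= rho U.
Proof. exact: bigmax_ge_id. Qed.

Lemma gram_posdef (R : realType) d n (U : 'M[R]_(d, n)) :
  row_free U -> posdef (U *m U^T).
Proof.
by move=> fU; rewrite -frame_op_const1; apply: frame_op_posdef.
Qed.

(* For L = B B^T with B = (U U^T)^(-1/2) U_T, this says L <= (1 + rho) L^2: the
   vector B^T w lies in the row space of B, so it equals B^+ (L w). *)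
Lemma rho_gram (R : realType) d n (U : 'M[R]_(d, n)) (T : {set 'I_n}) x :
  row_free U ->
  qform (frame_op U (ind R T)) x <= (1 + rho U) *
    qform (frame_op U (ind R T) *m invmx (U *m U^T) *m frame_op U (ind R T)) x.
Proof.
move=> fU; set G := frame_op U (ind R T); have [T0|T0] := eqVneq T finset.set0.
  (* The maximum in [rho] does not range over the empty T, where both sides vanish. *)
  suff -> : G = 0 by rewrite /qform !(mul0mx, mulmx0) mxE mulr0.
  rewrite /G /frame_op; suff -> : diagz (ind R T) = 0 :> 'M[R]_n.
    by rewrite mulmx0 mul0mx.
  by apply/matrixP => i j; rewrite !mxE /ind T0 inE mul0rn.
have [ST SS uS] := invsqrtmxP (gram_posdef fU).
have rhoX : rhoT U T <= rho U by apply: (le_bigmax_cond _ (rhoT U)).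
rewrite /rhoT in rhoX; set S := invsqrtmx _ in ST SS uS rhoX.
have [B BE] : exists B, B = S *m colsT U T by exists (S *m colsT U T).
rewrite -BE in rhoX.
have [BXB XBX _ XBT] := pinvP B; set X := Defs.pinv B in BXB XBX XBT rhoX.
rewrite lerBlDl in rhoX; clearbody X S.
(* Chosen so that B^T w = U_T^T x and B B^T w = S G x, whose squared norms are the two forms to be
   compared. *)
pose w := invmx S *m x.
have Bw : B^T *m w = (colsT U T)^T *m x.
  by rewrite BE trmx_mul ST -mulmxA mulKVmx.
have XBw : X *m (B *m B^T *m w) = B^T *m w.
  by rewrite !mulmxA -XBT -[in RHS]BXB -(mulmxA B) [in RHS]trmx_mul.
have BBw : B *m B^T *m w = S *m G *m x.
  by rewrite -mulmxA Bw BE -mulmxA (mulmxA (colsT U T)) colsT_gram mulmxA.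
have := vnorm_opnorm X (B *m B^T *m w).
rewrite -ler_sqr ?nnegrE ?mulr_ge0 ?vnorm_ge0 ?opnorm_ge0 // exprMn !vnorm_sqr.
rewrite XBw Bw qform1_mul trmxK colsT_gram BBw -mulmxA qform1_mul ST SS.
have GT : G^T = G by exact: frame_op_sym.
have -> : qform (invmx (U *m U^T)) (G *m x) =
    qform (G *m invmx (U *m U^T) *m G) x.
  by rewrite -{2}GT qform_congr.
move=> /le_trans; apply; rewrite ler_wpM2r //.
rewrite -{1}GT qform_congr -SS -{1}ST -qform1_mul.
exact: qform1_ge0.
Qed.

(** The hypothesis makes B B^T idempotent for B = (U U^T)^(-1/2) U_T, so B preserves norms on its
    row space. As B^+ x lies there, its norm is that of B B^+ x; and B B^+ is an orthogonal
    projection, so B^+ has norm at most 1. *)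
Lemma rho_le0 (R : realType) d n (U : 'M[R]_(d, n)) : row_free U ->
  (forall T : {set 'I_n},
     frame_op U (ind R T) *m invmx (U *m U^T) *m frame_op U (ind R T) =
     frame_op U (ind R T)) -> rho U <= 0.
Proof.
move=> fU GG; apply: bigmax_le => // T _.
have [ST SS uS] := invsqrtmxP (gram_posdef fU).
rewrite /rhoT; set S := invsqrtmx _ in ST SS uS *.
have [B BE] : exists B, B = S *m colsT U T by exists (S *m colsT U T).
rewrite -BE.
have [BXB XBX BXT XBT] := pinvP B; set X := Defs.pinv B in BXB XBX BXT XBT *.
clearbody X S.
rewrite subr_le0 expr_le1 ?opnorm_ge0 //; apply: opnorm_le1 => x.
have LE : B *m B^T = S *m frame_op U (ind R T) *m S.
  by rewrite BE trmx_mul ST -colsT_gram !mulmxA.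
have LL : B *m B^T *m (B *m B^T) = B *m B^T.
  rewrite LE -[in RHS]GG -SS !mulmxA //.
have [w yE] : exists w, X *m x = B^T *m w.
  by exists (X^T *m (X *m x)); rewrite mulmxA -trmx_mul XBT !mulmxA XBX.
have -> : qform 1%:M (X *m x) = qform 1%:M (B *m X *m x).
  by rewrite -mulmxA yE (mulmxA B) !qform1_mul trmx_mul trmxK LL.
pose P := B *m X; rewrite -/P.
have PT : P^T = P by [].
have PP : P^T *m P = P by rewrite BXT mulmxA BXB.
have -> : qform 1%:M x = qform 1%:M (P *m x) + qform 1%:M ((1%:M - P) *m x).
  rewrite !qform1_mul -qformD PP [(1%:M - P)^T]linearB /= trmx1 mulmxBl !mulmxBr.
  by rewrite !mul1mx mulmx1 PP PT subrr subr0 addrC subrK.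
by rewrite lerDl qform1_ge0.
Qed.

(** * Leverage scores: trace formulas and monotonicity *)

Lemma invmx_pencil (R : rcfType) n (W : 'M[R]_n) (E : 'rV[R]_n) :
  W \in unitmx -> (forall i, E 0 i != 0) ->
  invmx (W^T *m diag_mx E *m W) =
  invmx W *m diag_mx (\row_i (E 0 i)^-1) *m invmx W^T.
Proof.
move=> uW E0; have uWT : W^T \in unitmx by rewrite unitmx_tr.
have EE : diag_mx (\row_i (E 0 i)^-1) *m diag_mx E = 1%:M.
  rewrite mulmx_diag -diag_const_mx; congr diag_mx; apply/rowP => i.
  by rewrite !mxE mulVf.
have LR : invmx W *m diag_mx (\row_i (E 0 i)^-1) *m invmx W^T *m
    (W^T *m diag_mx E *m W) = 1%:M.
  by rewrite !mulmxA mulmxKV // -(mulmxA _ _ (diag_mx E)) EE mulmx1 mulVmx.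
have [_ uA] := mulmx1_unit LR.
by rewrite -[RHS]mulmx1 -(mulmxV uA) mulmxA LR mul1mx.
Qed.

(** The factors W cancel up to a conjugation, which the trace does not see. *)
Lemma mxtrace_pencil (R : rcfType) n (W : 'M[R]_n) (D E : 'rV[R]_n) :
  W \in unitmx -> (forall i, E 0 i != 0) ->
  \tr (W^T *m diag_mx D *m W *m invmx (W^T *m diag_mx E *m W)) =
  \sum_i D 0 i / E 0 i.
Proof.
move=> uW E0; have uWT : W^T \in unitmx by rewrite unitmx_tr.
rewrite invmx_pencil // !mulmxA mulmxK // mxtrace_mulC !mulmxA mulVmx //.
rewrite mul1mx mulmx_diag mxtrace_diag.
by apply: eq_bigr => i _; rewrite !mxE.
Qed.

Lemma levE (R : realType) d n (U : 'M[R]_(d, n)) z j :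
  lev U z j = z j * qform (invmx (frame_op U z)) (col j U).
Proof. by []. Qed.

(** Raising the other weights enlarges the frame operator in the Loewner order, which shrinks its
    inverse. *)
Lemma lev_anti (R : realType) d n (U : 'M[R]_(d, n)) (y z : 'I_n -> R) j :
  row_free U -> (forall i, 0 < y i) -> (forall i, y i <= z i) -> y j = z j ->
  lev U z j <= lev U y j.
Proof.
move=> fU y0 yz yzj; have z0 i : 0 < z i := lt_le_trans (y0 i) (yz i).
rewrite !levE yzj ler_pM2l //; apply: qform_inv_anti; try exact: frame_op_posdef.
by move=> x; rewrite !qform_frame ler_sum // => i _; rewrite ler_wpM2r ?sqr_ge0.
Qed.

Lemma lev_scale (R : realType) d n (U : 'M[R]_(d, n)) (z : 'I_n -> R) c j :
  row_free U -> (forall i, 0 < z i) -> 0 < c ->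
  lev U (fun i => c * z i) j = lev U z j.
Proof.
move=> fU z0 c0; rewrite !levE.
have -> : frame_op U (fun i => c * z i) = c *: frame_op U z.
  rewrite /frame_op scalemxAl scalemxAr; congr (_ *m _ *m _).
  by apply/matrixP => i k; rewrite !mxE mulrnAr.
rewrite invmxZ; last by rewrite unitmxZ ?unitfE ?gt_eqF // posdef_unit //; apply: frame_op_posdef.
by rewrite qformZ mulrACA mulfV ?mul1r // gt_eqF.
Qed.

(** The scores are the diagonal entries of Z U^T (U Z U^T)^(-1) U, and the trace is cyclic. *)
Lemma sum_lev (R : realType) d n (U : 'M[R]_(d, n)) (z : 'I_n -> R)
    (T : {set 'I_n}) :
  \sum_(j in T) lev U z j =
  \tr (frame_op U (fun i => ind R T i * z i) *m invmx (frame_op U z)).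
Proof.
pose K := U^T *m invmx (frame_op U z) *m U.
have levK j : lev U z j = z j * K j j by rewrite levE colE -qform_congr qform_delta.
have -> : \tr (frame_op U (fun i => ind R T i * z i) *m invmx (frame_op U z)) =
    \tr (diagz (fun i => ind R T i * z i) *m K).
  by rewrite {1}/frame_op -!mulmxA mxtrace_mulC /K !mulmxA.
clearbody K; rewrite big_mkcond /mxtrace; apply: eq_bigr => j _.
rewrite mul_diag_mx !mxE /ind levK.
by case: (j \in T); rewrite ?mul0r // mul1r.
Qed.

Lemma sum_lev_all (R : realType) d n (U : 'M[R]_(d, n)) (z : 'I_n -> R) :
  row_free U -> (forall i, 0 < z i) -> \sum_j lev U z j = d%:R.
Proof.
move=> fU z0; transitivity (\sum_(j in [set: 'I_n]) lev U z j).
  by apply: eq_bigl => j; rewrite inE.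
rewrite sum_lev; have -> : (fun i => ind R [set: 'I_n] i * z i) = z.
  by apply: funext => i; rewrite /ind inE mul1r.
by rewrite mulmxV ?mxtrace1 // posdef_unit //; apply: frame_op_posdef.
Qed.

Lemma sum_lev_setC (R : realType) d n (U : 'M[R]_(d, n)) (z : 'I_n -> R)
    (T : {set 'I_n}) :
  row_free U -> (forall i, 0 < z i) ->
  \sum_(j in T) lev U z j = d%:R - \sum_(j in ~: T) lev U z j.
Proof.
move=> fU z0; apply/esym/eqP.
rewrite subr_eq -(sum_lev_all fU z0) (bigID (mem T)) /=; apply/eqP.
by congr (_ + _); apply: eq_bigl => j; rewrite inE.
Qed.

(** Pass from w to y through u, which changes the entries on T first. That lowers the scores off T,
    and the total is always d; lowering the entries off T afterwards raises each score in T. *)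
Lemma sum_lev_mono (R : realType) d n (U : 'M[R]_(d, n)) (w y : 'I_n -> R)
    (T : {set 'I_n}) : row_free U -> (forall i, 0 < w i) -> (forall i, 0 < y i) ->
  (forall i, i \in T -> w i <= y i) -> (forall i, i \notin T -> y i <= w i) ->
  \sum_(j in T) lev U w j <= \sum_(j in T) lev U y j.
Proof.
move=> fU w0 y0 wyT ywT; pose u i := if i \in T then y i else w i.
have u0 i : 0 < u i by rewrite /u; case: ifP.
apply: (@le_trans _ _ (\sum_(j in T) lev U u j)).
  rewrite (sum_lev_setC T fU w0) (sum_lev_setC T fU u0) lerD2l lerN2; apply: ler_sum => j.
  rewrite inE => jT; apply: lev_anti => // [i|]; rewrite /u ?(negPf jT) //.
  by case: ifP => // /wyT.
apply: ler_sum => j jT; apply: lev_anti => // [i|]; rewrite /u ?jT //.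
by case: ifPn => // /ywT.
Qed.

(** * Generalized eigenvalues of U_T U_T^T relative to U U^T *)

Section GramEigenvalues.
Variables (R : realType) (d n : nat) (U : 'M[R]_(d, n)) (T : {set 'I_n}).
Variables (W : 'M[R]_d) (D : 'rV[R]_d).
Hypotheses (fU : row_free U) (uW : W \in unitmx).
Hypothesis UE : U *m U^T = W^T *m W.
Hypothesis GE : frame_op U (ind R T) = W^T *m diag_mx D *m W.

Lemma gram_setC : frame_op U (ind R (~: T)) = W^T *m diag_mx (\row_i (1 - D 0 i)) *m W.
Proof.
have -> : diag_mx (\row_i (1 - D 0 i)) = 1%:M - diag_mx D.
  by apply/matrixP => i j; rewrite !mxE mulrnBl.
by rewrite mulmxBr mulmxBl mulmx1 -UE -GE -(frame_op_setC U T) addrC addKr.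
Qed.

Lemma gram_inv : invmx (U *m U^T) = invmx W *m invmx W^T.
Proof.
have := @invmx_pencil R d W (const_mx 1) uW.
rewrite diag_const_mx mulmx1 -UE => -> => [|i]; last by rewrite mxE oner_eq0.
rewrite (_ : \row_i _ = const_mx 1) ?diag_const_mx ?mulmx1 //.
by apply/rowP => i; rewrite !mxE invr1.
Qed.

Lemma gram_mul :
  frame_op U (ind R T) *m invmx (U *m U^T) *m frame_op U (ind R T) =
  W^T *m diag_mx (\row_i (D 0 i ^+ 2)) *m W.
Proof.
have uWT : W^T \in unitmx by rewrite unitmx_tr.
rewrite gram_inv GE !mulmxA mulmxK // mulmxKV //.
by rewrite -(mulmxA W^T) mulmx_diag.
Qed.

(** Evaluation at the common eigenvectors turns inequalities between forms into inequalities between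
    eigenvalues. *)
Lemma qform_eigenvector (E : 'rV[R]_d) i :
  qform (W^T *m diag_mx E *m W) (invmx W *m delta_mx i 0) = E 0 i.
Proof. by rewrite qform_congr mulKVmx // qform_delta mxE eqxx mulr1n. Qed.

Lemma gram_eigen_ge0 i : 0 <= D 0 i.
Proof.
rewrite -qform_eigenvector -GE qform_frame sumr_ge0 // => j _.
by rewrite mulr_ge0 ?sqr_ge0 ?ler0n.
Qed.

(** This is [rho_gram] at a common eigenvector; dividing by D 0 i, a nonzero eigenvalue is at least
    1 / (1 + rho U). *)
Lemma gram_eigen_gap i : D 0 i <= (1 + rho U) * D 0 i ^+ 2.
Proof.
have := rho_gram T (invmx W *m delta_mx i 0) fU.
by rewrite gram_mul GE !qform_eigenvector mxE.
Qed.

End GramEigenvalues.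

(** The upper bound 1 comes from the complement of T, whose eigenvalues 1 - D 0 i are nonnegative as
    well. *)
Lemma gram_diagonalization (R : realType) d n (U : 'M[R]_(d, n)) (T : {set 'I_n}) :
  row_free U -> exists (W : 'M[R]_d) (D : 'rV[R]_d),
    [/\ W \in unitmx, U *m U^T = W^T *m W,
        frame_op U (ind R T) = W^T *m diag_mx D *m W
      & forall i, 0 <= D 0 i <= 1].
Proof.
move=> fU; have [W [D [uW UE GE]]] :=
  simultaneous_diagonalization (gram_posdef fU) (frame_op_sym U (ind R T)).
exists W, D; split=> // i; rewrite (gram_eigen_ge0 uW GE) /=.
have := gram_eigen_ge0 uW (gram_setC UE GE) i.
by rewrite mxE subr_ge0.
Qed.

(* An eigenvalue 0 < l < 1 for T is an eigenvalue 1 - l for the complement of T,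
   and one of the two is at most 1/2. *)
Lemma rho_ge1_or_eq0 (R : realType) d n (U : 'M[R]_(d, n)) :
  row_free U -> 1 <= rho U \/ rho U = 0.
Proof.
move=> fU; have [|rho1] := leP 1 (rho U); [by left | right].
apply/eqP; rewrite eq_le rho_ge0 andbT; apply: rho_le0 => // T.
have [W [D [uW UE GE D01]]] := gram_diagonalization T fU.
rewrite (gram_mul uW UE GE) GE; congr (_ *m diag_mx _ *m _).
apply/rowP => i; rewrite mxE; have /andP[D0 D1] := D01 i.
have gapT := gram_eigen_gap fU uW UE GE i.
have := gram_eigen_gap fU uW UE (gram_setC UE GE) i; rewrite mxE => gapC.
(* Idempotence asks for eigenvalues 0 or 1; for a value in between, the two gap bounds would add up
   to 2 <= 1 + rho U. *)
have [->|Dn0] := eqVneq (D 0 i) 0; first by rewrite expr0n.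
have [->|Dn1] := eqVneq (D 0 i) 1; first by rewrite expr1n.
have D_gt0 : 0 < D 0 i by rewrite lt_def Dn0.
have D_lt1 : 0 < 1 - D 0 i by rewrite subr_gt0 lt_def eq_sym Dn1.
have : 1 <= (1 + rho U) * D 0 i by rewrite -(ler_pM2r D_gt0) mul1r -mulrA.
have : 1 <= (1 + rho U) * (1 - D 0 i) by rewrite -(ler_pM2r D_lt1) mul1r -mulrA.
by lra.
Qed.

(** * Bounds for the sum of the scores in T *)

Lemma sum_lev_two_level (R : realType) d n (U : 'M[R]_(d, n)) (T : {set 'I_n})
    (W : 'M[R]_d) (D : 'rV[R]_d) s t : W \in unitmx -> U *m U^T = W^T *m W ->
  frame_op U (ind R T) = W^T *m diag_mx D *m W -> (forall i, 0 <= D 0 i <= 1) ->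
  0 < s -> 0 < t ->
  \sum_(j in T) lev U (fun i => if i \in T then s else t) j =
  \sum_i s * D 0 i / (s * D 0 i + t * (1 - D 0 i)).
Proof.
move=> uW UE GE D01 s0 t0; rewrite sum_lev.
rewrite (@frame_op_lin _ _ _ U T s t (fun i => if _ then _ else _)) //.
(* The numerator has weight s on T and 0 off T. *)
rewrite (@frame_op_lin _ _ _ U T s 0) => [|i]; last first.
  by rewrite /ind; case: (i \in T); rewrite ?mul1r ?mul0r.
have lin a b : a *: frame_op U (ind R T) + b *: frame_op U (ind R (~: T)) =
    W^T *m diag_mx (\row_i (a * D 0 i + b * (1 - D 0 i))) *m W.
  rewrite (gram_setC UE GE) GE.
  have -> : diag_mx (\row_i (a * D 0 i + b * (1 - D 0 i))) =
      a *: diag_mx D + b *: diag_mx (\row_i (1 - D 0 i)).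
    by apply/matrixP => i j; rewrite !mxE mulrnDl !mulrnAr.
  by rewrite mulmxDr mulmxDl -!scalemxAr -!scalemxAl.
rewrite !lin mxtrace_pencil // => [|i].
  by apply: eq_bigr => i _; rewrite !mxE mul0r addr0.
rewrite mxE gt_eqF //; have /andP[D0 D1] := D01 i; nra.
Qed.

(* The witness r is the rank of U_T. *)
Lemma sum_lev_bounds (R : realType) d n (U : 'M[R]_(d, n)) (T : {set 'I_n}) :
  row_free U -> exists2 r : nat, (r <= d)%N &
    (forall y : 'I_n -> R, (forall i, 0 < y i) -> \sum_(j in T) lev U y j <= r%:R) /\
    (forall (y : 'I_n -> R) (s t delta : R), (forall i, 0 < y i) ->
       0 < s -> 0 < t -> 0 <= delta -> t * rho U <= delta * s ->
       (forall i, i \in T -> s <= y i) -> (forall i, i \notin T -> y i <= t) ->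
       (1 - delta) * r%:R <= \sum_(j in T) lev U y j).
Proof.
move=> fU; have [W [D [uW UE GE D01]]] := gram_diagonalization T fU.
have Egt0 s t i : 0 < s -> 0 < t -> 0 < s * D 0 i + t * (1 - D 0 i).
  by move=> s0 t0; have /andP[D0 D1] := D01 i; nra.
(* Each nonzero eigenvalue contributes at most 1 and, across a wide gap, at least 1 - delta; zero
   eigenvalues contribute nothing. *)
exists #|[set i | D 0 i != 0]|; first by rewrite (leq_trans (max_card _)) ?card_ord.
have rE : #|[set i | D 0 i != 0]|%:R = \sum_i (D 0 i != 0)%:R :> R.
  by rewrite -sum1_card natr_sum big_mkcond /=; apply: eq_bigr => i _; rewrite inE; case: eqP.
split=> [y y0|y s t delta y0 s0 t0 delta0 trho sy yt].
  (* Any s above and t below all entries of y would do; the summand 1 and the default 1 keep them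
     positive even when n = 0. *)
  pose s := 1 + \sum_i y i; pose t := \big[Num.min/1]_i y i.
  have s0 : 0 < s by rewrite ltr_pwDl ?sumr_ge0 // => i _; apply: ltW.
  have t0 : 0 < t by apply: lt_bigmin.
  apply: (@le_trans _ _ (\sum_(j in T) lev U (fun i => if i \in T then s else t) j)).
    apply: sum_lev_mono => // [i|i iT|i /negPf iT]; first by case: ifP.
      rewrite iT /s (bigD1 i) //= addrCA lerDl addr_ge0 // sumr_ge0 // => j _.
      exact: ltW.
    by rewrite iT /t (bigD1 i) //= ge_min lexx.
  rewrite (sum_lev_two_level uW UE GE) // rE; apply: ler_sum => i _.
  have [->|Dn0] := eqVneq (D 0 i) 0; first by rewrite mulr0 mul0r.
  rewrite ler_pdivrMr ?Egt0 // mul1r lerDl mulr_ge0 ?(ltW t0) // subr_ge0.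
  by have /andP[] := D01 i.
apply: (@le_trans _ _ (\sum_(j in T) lev U (fun i => if i \in T then s else t) j)); last first.
  apply: sum_lev_mono => // [i|i iT|i /negPf iT]; first by case: ifP.
    by rewrite iT sy.
  by rewrite iT yt // iT.
rewrite (sum_lev_two_level uW UE GE) // rE mulr_sumr; apply: ler_sum => i _.
have [->|Dn0] := eqVneq (D 0 i) 0; first by rewrite !mulr0 mul0r.
have /andP[D0 D1] := D01 i; have D_gt0 : 0 < D 0 i by rewrite lt_def Dn0.
rewrite ler_pdivlMr ?Egt0 // mulr1.
have gap : 1 <= (1 + rho U) * D 0 i.
  by rewrite -(ler_pM2r D_gt0) mul1r -mulrA; apply: gram_eigen_gap fU uW UE GE i.
(* For l = D 0 i the gap gives 1 - l <= rho l, so the part t (1 - l) of the denominator is at most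
   delta times the part s l. *)
have tD : t * (1 - D 0 i) <= delta * (s * D 0 i).
  have : t * (1 - D 0 i) <= t * rho U * D 0 i by nra.
  move=> /le_trans; apply; rewrite mulrA ler_wpM2r //.
have : 0 <= t * (1 - D 0 i) by rewrite mulr_ge0 ?subr_ge0 // (ltW t0).
set q := t * _ in tD *; set p := s * _ in tD *.
have : 0 <= p by rewrite mulr_ge0 // ltW.
by nra.
Qed.

(** Scores grow on T and shrink off T with constant total, so the distance is twice the growth on T.
    That growth takes place between (1 - delta) r and r, with r <= d. *)
Lemma lev_rescale_dist (R : realType) d n (U : 'M[R]_(d, n)) (T : {set 'I_n})
    (y z : 'I_n -> R) (a s t delta : R) : row_free U -> (forall i, 0 < y i) ->
  1 <= a -> (forall i, z i = if i \in T then a * y i else y i) ->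
  0 < s -> 0 < t -> 0 <= delta -> t * rho U <= delta * s ->
  (forall i, i \in T -> s <= y i) -> (forall i, i \notin T -> y i <= t) ->
  \sum_j `|lev U z j - lev U y j| <= 2 * d%:R * delta.
Proof.
move=> fU y0 a1 zE s0 t0 delta0 trho sy yt.
have a0 : 0 < a by apply: lt_le_trans a1.
have z0 i : 0 < z i by rewrite zE; case: ifP => // _; rewrite mulr_gt0.
have levT j : j \in T -> lev U y j <= lev U z j.
  (* The vector a y has the same scores as y, agrees with z on T and dominates it elsewhere. *)
  move=> jT; rewrite -(lev_scale j fU y0 a0); apply: lev_anti => // [i|].
    by rewrite zE; case: ifP => // _; rewrite ler_peMl // ltW.
  by rewrite zE jT.
have levC j : j \notin T -> lev U z j <= lev U y j.
  move=> jT; apply: lev_anti => // [i|]; last by rewrite zE (negPf jT).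
  by rewrite zE; case: ifP => // _; rewrite ler_peMl // ltW.
have -> : \sum_j `|lev U z j - lev U y j| =
    2 * (\sum_(j in T) lev U z j - \sum_(j in T) lev U y j).
  rewrite (bigID (mem T)) /=.
  rewrite (eq_bigr (fun j => lev U z j - lev U y j)) => [|j jT]; last first.
    by rewrite ger0_norm // subr_ge0 levT.
  rewrite [X in _ + X](eq_bigr (fun j => lev U y j - lev U z j)) => [|j jT]; last first.
    by rewrite ler0_norm ?opprB // subr_le0 levC.
  rewrite !sumrB; have := sum_lev_all fU z0; have := sum_lev_all fU y0.
  by rewrite !(bigID (mem T) xpredT) /=; lra.
have [r rd [le_r ge_r]] := sum_lev_bounds T fU.
have := le_r z z0; have := ge_r y s t delta y0 s0 t0 delta0 trho sy yt.
have : delta * r%:R <= delta * d%:R by rewrite ler_wpM2l // ler_nat.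
by lra.
Qed.

(** * Closing the wide gaps between consecutive weights *)

(** A gap is marked by the indices j at its upper end, so at most n indices are marked. The first
    conjunct excludes the smallest value, which has nothing below it. *)
Definition wide_gap (R : realType) n (kappa : R) (z : 'I_n -> R) (j : 'I_n) :=
  [exists i, z i < z j] && [forall i, (z i < z j) ==> (kappa * z i < z j)].

(** All entries from z j upwards shrink by one factor c. This keeps their mutual ratios and the
    order of all entries, so no new wide gap appears. *)
Lemma close_gap (R : realType) d n (U : 'M[R]_(d, n)) (z : 'I_n -> R) j delta :
  row_free U -> (forall i, 0 < z i) -> 0 < delta < rho U ->
  wide_gap (rho U / delta) z j ->
  exists z' : 'I_n -> R, [/\ forall i, 0 < z' i,
    \sum_j `|lev U z j - lev U z' j| <= 2 * d%:R * delta
    & [set i | wide_gap (rho U / delta) z' i] \proper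
      [set i | wide_gap (rho U / delta) z i]].
Proof.
move=> fU z0 /andP[delta0 delta_rho] wj; set kappa := rho U / delta in wj *.
have kappa1 : 1 < kappa by rewrite ltr_pdivlMr ?mul1r.
have [/existsP[i0 i0j] /forallP gapj] := andP wj.
pose i1 := [arg max_(i > i0 | z i < z j) z i]%O.
have [i1j i1max] : z i1 < z j /\ forall i, z i < z j -> z i <= z i1.
  by rewrite /i1; case: arg_maxP.
(* Brings z j down to exactly [kappa] times the largest entry below it. *)
pose c := kappa * z i1 / z j.
have c0 : 0 < c by rewrite divr_gt0 // mulr_gt0 // (lt_trans ltr01).
have cj : c * z j = kappa * z i1 by rewrite divfK ?gt_eqF.
have c1 : c < 1 by rewrite ltr_pdivrMr // mul1r (implyP (gapj i1)).
pose z' i := if z j <= z i then c * z i else z i.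
have z'0 i : 0 < z' i by rewrite /z'; case: ifP => // _; rewrite mulr_gt0.
exists z'; split=> //.
  (* Read backwards: z arises from z' by scaling up by 1 / c, and z' still has ratio [kappa] = rho U
     / delta across the gap. *)
  apply: (@lev_rescale_dist _ _ _ U [set i | z j <= z i] z' z c^-1 (kappa * z i1) (z i1)) => //.
  - by rewrite invf_ge1 // ltW.
  - by move=> i; rewrite inE /z'; case: (z j <= z i); rewrite // mulKf // gt_eqF.
  - by rewrite mulr_gt0 // (lt_trans ltr01).
  - exact: ltW.
  - by rewrite /kappa mulrA [delta * _]mulrC divfK ?gt_eqF // mulrC.
  - by move=> i; rewrite inE /z' => ji; rewrite ji -cj ler_pM2l.
  by move=> i; rewrite inE => /negPf ij; rewrite /z' ij i1max // ltNge ij.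
have kz i : z j <= z i -> kappa * z i1 <= c * z i.
  by move=> ji; rewrite -cj ler_pM2l.
have i1lt i : z j <= z i -> z i1 < c * z i.
  move=> /kz; apply: lt_le_trans; rewrite ltr_pMl //.
have z'lt i k : (z' i < z' k) = (z i < z k).
  rewrite /z'; case: (leP (z j) (z i)) => ji; case: (leP (z j) (z k)) => jk //.
  - by rewrite ltr_pM2l.
  - rewrite [RHS]lt_gtF ?(lt_le_trans jk) //; apply: lt_gtF.
    exact: le_lt_trans (i1max _ jk) (i1lt _ ji).
  rewrite (lt_le_trans ji jk); exact: le_lt_trans (i1max _ ji) (i1lt _ jk).
apply/properP; split.
  apply/fintype.subsetP => k; rewrite !inE => /andP[/existsP[i ik] /forallP gapk].
  apply/andP; split; first by apply/existsP; exists i; rewrite -z'lt.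
  apply/forallP => l; apply/implyP => lk.
  have /implyP := gapk l; rewrite z'lt => /(_ lk); rewrite /z'.
  case: (leP (z j) (z l)) => jl; case: (leP (z j) (z k)) => jk //.
  - by rewrite mulrCA ltr_pM2l.
  - by have := le_lt_trans jl (lt_trans lk jk); rewrite ltxx.
  (* For l below and k above the closed gap, the ratio in z was already larger than [kappa]. *)
  move=> _; have /implyP/(_ jl) := gapj l; move=> /lt_le_trans; exact.
(* At j the ratio to i1 is now equal to [kappa], which the strict inequality rejects. *)
exists j; rewrite !inE // negb_and negb_forall; apply/orP; right.
apply/existsP; exists i1; rewrite z'lt i1j /= /z' lexx leNgt i1j /= cj.
by rewrite ltxx.
Qed.

Lemma close_gaps (R : realType) d n (U : 'M[R]_(d, n)) (z : 'I_n -> R) delta :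
  row_free U -> (forall i, 0 < z i) -> 0 < delta < rho U ->
  exists z' : 'I_n -> R, [/\ forall i, 0 < z' i,
    \sum_j `|lev U z j - lev U z' j| <= 2 * n%:R * d%:R * delta
    & forall i, ~~ wide_gap (rho U / delta) z' i].
Proof.
move=> fU z0 hdelta; have /andP[delta0 _] := hdelta.
(* Induction on the number of marked indices: each closing costs 2 d delta and removes at least one
   of them. *)
suff [z' [z'0 z'd z'g]] : exists z' : 'I_n -> R, [/\ forall i, 0 < z' i,
    \sum_j `|lev U z j - lev U z' j| <=
      #|[set i | wide_gap (rho U / delta) z i]|%:R * (2 * d%:R * delta)
    & forall i, ~~ wide_gap (rho U / delta) z' i].
  exists z'; split=> //; apply: le_trans z'd _.
  rewrite [2 * n%:R]mulrC -!mulrA ler_wpM2r ?mulr_ge0 ?ler0n ?(ltW delta0) //.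
  by rewrite ler_nat (leq_trans (max_card _)) ?card_ord.
have [m] := ubnP #|[set i | wide_gap (rho U / delta) z i]|.
elim: m z z0 => // m IH z z0 zm.
have [g0|[j]] := set_0Vmem [set i | wide_gap (rho U / delta) z i].
  exists z; split=> // [|i].
    rewrite big1 ?mulr_ge0 ?ler0n ?(ltW delta0) // => j _.
    by rewrite subrr normr0.
  by apply/negP => gi; have := finset.in_set0 i; rewrite -g0 inE gi.
rewrite inE => /(close_gap fU z0 hdelta)[y [y0 dzy /proper_card gy]].
have [|z' [z'0 dyz' z'g]] := IH y y0; first exact: leq_trans gy _.
exists z'; split=> //; apply: (@le_trans _ _
    (\sum_j `|lev U z j - lev U y j| + \sum_j `|lev U y j - lev U z' j|)).
  by rewrite -big_split ler_sum //= => j' _; apply: ler_distD.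
apply: le_trans (lerD dzy dyz') _.
rewrite -[X in X + _]mul1r -mulrDl ler_wpM2r ?mulr_ge0 ?ler0n ?(ltW delta0) //.
by rewrite nat1r ler_nat.
Qed.

(** Descend from z j: as long as the entry exceeds z i, a strictly smaller one lies within a factor
    [kappa]. The number of entries strictly below drops each time, which limits the descent to n
    steps. *)
Lemma ratio_bound (R : realType) n (kappa : R) (z : 'I_n -> R) :
  1 <= kappa -> (forall i, 0 < z i) -> (forall i, ~~ wide_gap kappa z i) ->
  forall i j, z j <= kappa ^+ n * z i.
Proof.
move=> kappa1 z0 nogap i j.
have kappa0 : 0 < kappa by apply: lt_le_trans kappa1.
pose c j := #|[set k | z k < z j]|.
suff zc : z j <= kappa ^+ c j * z i.
  apply: le_trans zc _; rewrite ler_pM2r // ler_weXn2l //.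
  by rewrite (leq_trans (max_card _)) ?card_ord.
have [m] := ubnP (c j); elim: m j => // m IH j cm.
have [ij|ij] := leP (z j) (z i).
  by rewrite (le_trans ij) // ler_peMl ?exprn_ege1 // ltW.
have := nogap j; rewrite negb_and => /orP[/existsP[]|]; first by exists i.
rewrite negb_forall => /existsP[k]; rewrite negb_imply -leNgt => /andP[kj jk].
have ckj : (c k < c j)%N.
  apply: proper_card; apply/properP; split.
    by apply/fintype.subsetP => l; rewrite !inE => /lt_trans; apply.
  by exists k; rewrite !inE ?ltxx.
apply: le_trans jk _; have := IH k (leq_trans ckj cm).
rewrite -(ler_pM2l kappa0) => /le_trans; apply.
by rewrite mulrA -exprS ler_pM2r // ler_weXn2l.
Qed.

Lemma ln_zratio_le (R : realType) n (a : R) (z : 'I_n -> R) : 1 <= a ->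
  (forall i, 0 < z i) -> (forall i j, z j <= a * z i) -> ln (zmax z / zmin z) <= ln a.
Proof.
move=> a1 z0 za; have a0 : 0 < a by apply: lt_le_trans a1.
(* For n = 0 the default makes [zmax] 0, so the ratio is 0 and its [ln] is 0. *)
case: n z z0 za => [|n] z z0 za.
  by rewrite /zmax big_ord0 mul0r ln0 ?ln_ge0.
have zmax_gt0 : 0 < zmax z by apply: lt_le_trans (z0 ord0) (le_bigmax _ _ ord0).
have zmin_gt0 : 0 < zmin z by apply: lt_bigmin.
rewrite ler_ln ?posrE ?divr_gt0 // ler_pdivrMr // mulrC -ler_pdivrMr //.
have zmaxa k : zmax z / a <= z k.
  rewrite ler_pdivrMr // mulrC; apply: bigmax_le => [|j _]; last exact: za.
  by rewrite mulr_ge0 ?ltW.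
(* The default value zmax z in [zmin] has to be bounded below as well. *)
by apply: le_bigmin => [|k _]; rewrite ?zmaxa // ler_pdivrMr // ler_peMr // ltW.
Qed.

(** * Degenerate cases and conclusion *)

Lemma lev_ge0 (R : realType) d n (U : 'M[R]_(d, n)) (z : 'I_n -> R) j :
  row_free U -> (forall i, 0 < z i) -> 0 <= lev U z j.
Proof.
move=> fU z0; rewrite levE mulr_ge0 ?(ltW (z0 j)) //.
have [S [ST _] <-] := posdef_factor (frame_op_posdef fU z0).
by rewrite -{1}ST -qform1_mul qform1_ge0.
Qed.

(** Covers delta = 1: both score vectors are nonnegative with sum d, so their distance is at most 2
    d; for n = 0 it is an empty sum. *)
Lemma lev_dist_le (R : realType) d n (U : 'M[R]_(d, n)) (y z : 'I_n -> R) :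
  row_free U -> (forall i, 0 < y i) -> (forall i, 0 < z i) ->
  \sum_j `|lev U y j - lev U z j| <= 2 * n%:R * d%:R.
Proof.
move=> fU y0 z0; case: n U y z fU y0 z0 => [|n] U y z fU y0 z0.
  by rewrite big_ord0 mulr0 mul0r.
apply: (@le_trans _ _ (\sum_j (lev U y j + lev U z j))).
  apply: ler_sum => j _; apply: le_trans (ler_normB _ _) _.
  by rewrite !ger0_norm ?lev_ge0.
rewrite big_split /= !sum_lev_all //.
have d0 : 0 <= d%:R :> R by []; have n1 : 1 <= n.+1%:R :> R by rewrite ler1n.
by nra.
Qed.

Lemma lev_rho0 (R : realType) d n (U : 'M[R]_(d, n)) (y z : 'I_n -> R) j :
  row_free U -> rho U = 0 -> (forall i, 0 < y i) -> (forall i, 0 < z i) ->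
  lev U y j = lev U z j.
Proof.
move=> fU rho0 y0 z0; have [r _ [le_r ge_r]] := sum_lev_bounds [set j] fU.
suff levr x : (forall i, 0 < x i) -> lev U x j = r%:R by rewrite !levr.
move=> x0; apply/eqP; rewrite eq_le.
have := le_r x x0; rewrite big_set1 => -> /=.
(* With rho U = 0 no gap is required: t may exceed every entry and delta may be 0, so the lower
   bound meets the upper bound r. *)
have := ge_r x (x j) (1 + \sum_i x i) 0 x0; rewrite big_set1 subr0 mul1r.
apply=> // [||i|i _]; last 1 first.
- rewrite (bigD1 i) //= addrCA lerDl addr_ge0 // sumr_ge0 // => k _.
  exact: ltW.
- by rewrite ltr_pwDl // sumr_ge0 // => k _; apply: ltW.
- by rewrite rho0 mulr0 mul0r.
by rewrite inE => /eqP ->.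
Qed.

Theorem theorem4p6 (R : realType) (d n : nat) (U : 'M[R]_(d, n))
  (hU : row_free U) (z : 'I_n -> R) (hz : forall j, 0 < z j)
  (delta : R) (hd0 : 0 < delta) (hd1 : delta <= 1) :
  exists zh : 'I_n -> R, (forall j, 0 < zh j) /\
    \sum_j `|lev U z j - lev U zh j| <= 2 * n%:R * d%:R * delta /\
    ln (zmax zh / zmin zh) <= n%:R * ln (rho U / delta).
Proof.
have [delta_rho|rho_delta] := ltP delta (rho U).
  have kappa1 : 1 <= rho U / delta by rewrite ler_pdivlMr // mul1r ltW.
  have [|zh [zh0 dzh gaps]] := @close_gaps _ _ _ U z delta hU hz.
    by rewrite hd0.
  exists zh; split=> //; split=> //.
  rewrite mulr_natl -lnXn; last by apply: lt_le_trans kappa1.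
  apply: ln_zratio_le => //; first exact: exprn_ege1.
  exact: ratio_bound.
(* Constant weights make the left side of the second bound at most 0; the right side is 0, through
   [ln] 1 when rho U = delta = 1 and through the convention [ln] 0 = 0 when rho U = 0. *)
exists (fun=> 1); split=> //.
have := @ln_zratio_le R n 1 (fun=> 1) (lexx _) (fun=> ltr01).
rewrite ln1 mulr1 => /(_ (fun _ _ => lexx _)) ln_zratio0.
have [rho1|rho0] := rho_ge1_or_eq0 hU.
  have -> : delta = 1 by apply/eqP; rewrite eq_le hd1 (le_trans rho1).
  have -> : rho U = 1 by apply/eqP; rewrite eq_le rho1 (le_trans rho_delta).
  by rewrite mulr1 divr1 ln1 mulr0; split=> //; apply: lev_dist_le.
rewrite rho0 mul0r (ln0 (lexx 0)) mulr0; split=> //.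
rewrite big1 ?mulr_ge0 ?ler0n ?(ltW hd0) // => j _.
by rewrite (lev_rho0 j hU rho0 hz (fun=> ltr01)) subrr normr0.
Qed.
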